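(* Let $1\le p<\infty$ and let $T_f$ be a dissipative composition operator of bounded distortion on $L^p(X,\mathcal B,\mu)$, generated by a wandering set $W$. The following are equivalent: (i) $T_f$ is hypercyclic; (ii) $T_f$ is weakly mixing; (iii) there exists an increasing sequence $\{n_k\}_{k\ge 1}$ of positive integers such that, for every $j\in\mathbb Z$, $$\lim_{k\to+\infty}\frac{\mu(f^{j-n_k}(W))}{\mu(f^j(W))}=0\quad\text{and}\quad \lim_{k\to+\infty}\frac{\mu(f^{j}(W))}{\mu(f^{j+n_k}(W))}=\infty.$$
   Context: Setting. $(X,\mathcal B,\mu)$ is a $\sigma$-finite measure space and $f:X\to X$ is a bijective bimeasurable map (images and preimages of sets in $\mathcal B$ are in $\mathcal B$) such that there is $c>0$ with $\mu(f^{-1}(B))\le c\,\mu(B)$ and $\mu(f(B))\le c\,\mu(B)$ for every $B\in\mathcal B$. For $1\le p<\infty$, the composition operator induced by $f$ is the bounded linear operator $T_f:L^p(X,\mathcal B,\mu)\to L^p(X,\mathcal B,\mu)$, $T_f\varphi=\varphi\circ f$; it is invertible with $T_f^{-1}=T_{f^{-1}}$. The space $L^p(X,\mathcal B,\mu)$ is complex and assumed separable. $T_f$ is dissipative, generated by $W$, if $W\in\mathcal B$ is a wandering set (the sets $f^k(W)$, $k\in\mathbb Z$, are pairwise disjoint) with $0<\mu(W)<\infty$ and $X=\bigcup_{k\in\mathbb Z}f^k(W)$. It is moreover of bounded distortion if there exists $K>0$ such that $$\frac1K\,\mu(f^k(W))\,\mu(B)\le \mu(f^k(B))\,\mu(W)\le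 K\,\mu(f^k(W))\,\mu(B)$$ for all $k\in\mathbb Z$ and all $B\in\mathcal B$ with $B\subseteq W$. A bounded linear operator $T$ on a separable Banach space $Y$ is hypercyclic if there is $y\in Y$ whose orbit $\{T^ny:n\ge0\}$ is dense in $Y$; it is weakly mixing if $T\oplus T:(x,y)\mapsto(Tx,Ty)$ on $Y\times Y$ is hypercyclic. *)

(* Defs.v *)
From HB Require Import structures.
From mathcomp Require Import all_boot all_order all_algebra generic_quotient.
From mathcomp Require Import all_classical all_reals all_analysis.
From mathcomp Require Import measurable_realfun.
From mathcomp.real_closed Require Import complex.

Set Implicit Arguments.
Unset Strict Implicit.
Unset Printing Implicit Defensive.

Import Order.TTheory GRing.Theory Num.Theory.
Import numFieldNormedType.Exports.
Import ComplexField.Normc.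

Local Open Scope classical_set_scope.
Local Open Scope ring_scope.
Local Open Scope complex_scope.
Local Open Scope quotient_scope.

Section ComplexMeasurable.
Context d (X : measurableType d) (R : realType).
Implicit Types f g : X -> R[i].

(* R[i] carries no sigma-algebra in the library: measurability for the Borel
   sigma-algebra of the plane is that of the two coordinates. *)
Definition cmeasurable f :=
  measurable_fun [set: X] (fun x => complex.Re (f x)) /\
  measurable_fun [set: X] (fun x => complex.Im (f x)).

Lemma normc_sqrt (z : R[i]) :
  normc z = (complex.Re z ^+ 2 + complex.Im z ^+ 2) `^ 2^-1.
Proof. by case: z => a b /=; rewrite powR12_sqrt// addr_ge0 ?sqr_ge0. Qed.

Lemma normc_ge0 (z : R[i]) : 0 <= normc z.
Proof. by rewrite normc_sqrt powR_ge0. Qed.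

Lemma le_normcD (z w : R[i]) : normc (z + w) <= normc z + normc w.
Proof. exact: complex.le_normcD. Qed.

Lemma measurable_normc f : cmeasurable f ->
  measurable_fun [set: X] (fun x => normc (f x)).
Proof.
move=> [mr mi]; under eq_fun do rewrite normc_sqrt.
apply: (measurableT_comp (measurable_powR _)) => //.
by apply: measurable_funD; exact: measurable_funX.
Qed.

Lemma cmeasurable0 : cmeasurable (0 : X -> R[i]).
Proof. by split => /=; exact: measurable_cst. Qed.

Lemma cmeasurableD f g : cmeasurable f -> cmeasurable g -> cmeasurable (f + g).
Proof.
move=> [fr fi] [gr gi]; split.
  rewrite [X in measurable_fun _ X](_ : _ =
      fun x => complex.Re (f x) + complex.Re (g x)); last first.
    apply/funext => x; rewrite [(_ + _) x]/(f x + g x).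
    by case: (f x) (g x) => ? ? [].
  exact: measurable_funD.
rewrite [X in measurable_fun _ X](_ : _ =
    fun x => complex.Im (f x) + complex.Im (g x)); last first.
  apply/funext => x; rewrite [(_ + _) x]/(f x + g x).
  by case: (f x) (g x) => ? ? [].
exact: measurable_funD.
Qed.

Lemma cmeasurableZ (a : R[i]) f : cmeasurable f -> cmeasurable (a *: f).
Proof.
case: a => a b [fr fi]; split.
  rewrite [X in measurable_fun _ X](_ : _ =
      fun x => a * complex.Re (f x) - b * complex.Im (f x)); last first.
    by apply/funext => x; rewrite [(_ *: _) x]/((a +i* b) * f x); case: (f x).
  by apply: measurable_funB; exact: measurable_funM.
rewrite [X in measurable_fun _ X](_ : _ =
    fun x => a * complex.Im (f x) + b * complex.Re (f x)); last first.
  by apply/funext => x; rewrite [(_ *: _) x]/((a +i* b) * f x); case: (f x).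
by apply: measurable_funD; exact: measurable_funM.
Qed.

End ComplexMeasurable.

Section ComplexLnorm.
Context d (X : measurableType d) (R : realType).
Variables (mu : {measure set X -> \bar R}) (p : R).
Hypothesis p1 : 1 <= p.
Implicit Types f g : X -> R[i].
Local Open Scope ereal_scope.

Definition cLnorm f : \bar R := 'N[mu]_p%:E[EFin \o (fun x => normc (f x))].

Let p0 : (0 < p)%R. Proof. exact: lt_le_trans p1. Qed.

Lemma cLnormE f :
  cLnorm f = (\int[mu]_x ((normc (f x)) `^ p)%R%:E) `^ p^-1.
Proof.
rewrite /cLnorm unlock; congr (_ `^ _); apply: eq_integral => x _.
by rewrite /= ger0_norm ?normc_ge0.
Qed.

Lemma cLnorm_ge0 f : 0 <= cLnorm f. Proof. exact: Lnorm_ge0. Qed.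

Lemma cLnorm0 : cLnorm (0 : X -> R[i])%R = 0.
Proof.
rewrite cLnormE integral0_eq ?poweR0r ?invr_neq0 ?gt_eqF// => x _.
by rewrite normc0 powR0 ?gt_eqF.
Qed.

Lemma measurable_normcX f : cmeasurable f ->
  measurable_fun [set: X] (fun x => ((normc (f x)) `^ p)%R%:E).
Proof.
move=> mf; apply/measurable_EFinP.
by apply: (measurableT_comp (measurable_powR _)) => //; exact: measurable_normc.
Qed.

Lemma le_cLnormD f g : cmeasurable f -> cmeasurable g ->
  cLnorm (f + g)%R <= cLnorm f + cLnorm g.
Proof.
move=> mf mg.
have := @minkowski_EFin _ _ _ mu _ _ _ (measurable_normc mf)
  (measurable_normc mg) p1.
apply: le_trans; rewrite cLnormE unlock/=.
apply: gt0_ler_poweR; rewrite ?invr_ge0 ?(ltW p0)//.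
- rewrite in_itv/= leey andbT; apply: integral_ge0 => x _.
  by rewrite lee_fin powR_ge0.
- rewrite in_itv/= leey andbT; apply: integral_ge0 => x _.
  by rewrite lee_fin powR_ge0.
apply: ge0_le_integral => //.
- by move=> x _; rewrite lee_fin powR_ge0.
- exact: measurable_normcX (cmeasurableD mf mg).
- apply/measurable_EFinP.
  apply: (measurableT_comp (measurable_powR _)) => //.
  by apply: measurableT_comp => //; apply: measurable_funD;
    exact: measurable_normc.
move=> x _; rewrite lee_fin ge0_ler_powR ?nnegrE ?normc_ge0 ?(ltW p0)//.
by rewrite ger0_norm ?addr_ge0 ?normc_ge0// le_normcD.
Qed.

Lemma cLnormZ (a : R[i]) f : cmeasurable f ->
  cLnorm (a *: f)%R = (normc a)%:E * cLnorm f.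
Proof.
move=> mf; rewrite !cLnormE.
under eq_integral do
  rewrite [(_ *: _)%R _]/(a * f _)%R normcM powRM ?normc_ge0// EFinM.
rewrite ge0_integralZl_EFin ?powR_ge0//; last exact: measurable_normcX.
rewrite poweRM ?lee_fin ?powR_ge0 ?integral_ge0//; last first.
  by move=> *; rewrite lee_fin powR_ge0.
rewrite poweR_EFin -powRrM mulfV ?gt_eqF// powRr1 ?normc_ge0//.
by move=> x _; rewrite lee_fin powR_ge0.
Qed.

Lemma cLnorm_eq0 f : cmeasurable f -> cLnorm f = 0 ->
  {ae mu, forall x, f x = 0%R}.
Proof.
move=> mf /Lnorm_eq0_eq0; have /measurable_EFinP := measurable_normc mf.
move=> /[swap] /[apply]; rewrite lte_fin => /(_ p0).
by apply: filterS => x /(_ I) [] /eq0_normc.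
Qed.

Lemma ae_eq_cLnorm f g : cmeasurable f -> cmeasurable g ->
  {ae mu, forall x, f x = g x} -> cLnorm f = cLnorm g.
Proof.
move=> mf mg fg; rewrite !cLnormE; congr (_ `^ _); apply: ae_eq_integral => //.
- exact: measurable_normcX.
- exact: measurable_normcX.
- by move: fg; apply: filterS => x ->.
Qed.

End ComplexLnorm.

Section Lp.
Context d (X : measurableType d) (R : realType).
Variables (mu : {measure set X -> \bar R}) (p : R) (p1 : 1 <= p).

(* The proof of 1 <= p is an argument, as in LfunType, because the closure
   properties registered below depend on it. *)
Definition Lpfun_pred of 1 <= p : {pred X -> R[i]} :=
  fun f => `[< cmeasurable f /\ (cLnorm mu p f < +oo)%E >].
Local Notation Lpred := (Lpfun_pred p1).

Lemma LpfunP f :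
  reflect (cmeasurable f /\ (cLnorm mu p f < +oo)%E) (f \in Lpred).
Proof. exact: asboolP. Qed.

Lemma Lpfun_submod_closed : submod_closed Lpred.
Proof.
split; first by apply/LpfunP; split; [exact: cmeasurable0|rewrite cLnorm0].
move=> a f g /LpfunP[mf lf] /LpfunP[mg lg]; apply/LpfunP.
have maf := cmeasurableZ a mf; split; first exact: cmeasurableD.
rewrite (le_lt_trans (le_cLnormD _ _ maf mg))// lte_add_pinfty// cLnormZ//.
by rewrite lte_mul_pinfty// lee_fin normc_ge0.
Qed.

HB.instance Definition _ :=
  GRing.isSubmodClosed.Build _ _ Lpred Lpfun_submod_closed.

Record Lpfun := LpFun {
  Lpfun_val :> X -> R[i];
  Lpfun_valP : Lpfun_val \in Lpred }.

HB.instance Definition _ := [isSub for Lpfun_val].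
HB.instance Definition _ := [Choice of Lpfun by <:].
HB.instance Definition _ := [SubChoice_isSubLmodule of Lpfun by <:].

Lemma Lpfun_measurable (f : Lpfun) : cmeasurable f.
Proof. by have /LpfunP[] := Lpfun_valP f. Qed.

Lemma cLnorm_fin_num (f : Lpfun) : cLnorm mu p f \is a fin_num.
Proof.
by rewrite ge0_fin_numE ?cLnorm_ge0//; have /LpfunP[] := Lpfun_valP f.
Qed.

Definition Lpnull : {pred Lpfun} :=
  fun f => `[< {ae mu, forall x, f x = 0} >].

Lemma LpnullP (f : Lpfun) :
  reflect {ae mu, forall x, f x = 0} (f \in Lpnull).
Proof. exact: asboolP. Qed.

Lemma Lpnull_submod_closed : submod_closed Lpnull.
Proof.
split; first by apply/LpnullP; exact: aeW.
move=> a f g /LpnullP f0 /LpnullP g0; apply/LpnullP.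
apply: filterS2 f0 g0 => x fx gx; transitivity (a * f x + g x) => //.
by rewrite fx gx mulr0 addr0.
Qed.

HB.instance Definition _ :=
  GRing.isSubmodClosed.Build _ _ Lpnull Lpnull_submod_closed.

(* Classes of p-integrable functions modulo almost everywhere equality; see
   eq_LpP. *)
Definition Lp : Type := Quotient.quot Lpnull.
HB.instance Definition _ := GRing.Zmodule.on Lp.
HB.instance Definition _ := EqQuotient.on Lp.

Lemma eq_LpP (f g : Lpfun) :
  \pi_Lp f = \pi_Lp g <-> {ae mu, forall x, f x = g x}.
Proof.
split=> [/eqP|fg].
  rewrite -Quotient.idealrBE => /LpnullP; apply: filterS => x.
  by move=> /eqP; rewrite [X in X == _]/(f x - g x) subr_eq0 => /eqP.
apply/eqP; rewrite -Quotient.idealrBE; apply/LpnullP.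
apply: filterS fg => x fgx; transitivity (f x - g x) => //.
by rewrite fgx subrr.
Qed.

Lemma pi_LpD (f g : Lpfun) : \pi_Lp (f + g) = \pi_Lp f + \pi_Lp g.
Proof. exact: Quotient.pi_add. Qed.

Definition Lp_scale (a : R[i]) (u : Lp) : Lp := \pi_Lp (a *: repr u).

Lemma pi_scale a (f : Lpfun) : Lp_scale a (\pi_Lp f) = \pi_Lp (a *: f).
Proof.
apply/eq_LpP; have /eq_LpP := reprK (\pi_Lp f).
apply: filterS => x fx; transitivity (a * f x) => //.
by rewrite -fx.
Qed.

Lemma Lp_scaleA a b u : Lp_scale a (Lp_scale b u) = Lp_scale (a * b) u.
Proof. by rewrite -[u]reprK (pi_scale b) !pi_scale scalerA. Qed.

Lemma Lp_scale1 : left_id 1 Lp_scale.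
Proof. by move=> u; rewrite -[u]reprK pi_scale scale1r. Qed.

Lemma Lp_scaleDr : right_distributive Lp_scale +%R.
Proof.
move=> a u v; rewrite -[u]reprK -[v]reprK -pi_LpD !pi_scale -pi_LpD.
by rewrite scalerDr.
Qed.

Lemma Lp_scaleDl u : {morph Lp_scale^~ u : a b / a + b}.
Proof.
by move=> a b; rewrite -[u]reprK !pi_scale -pi_LpD scalerDl.
Qed.

HB.instance Definition _ := GRing.Zmodule_isLmodule.Build R[i] Lp
  Lp_scaleA Lp_scale1 Lp_scaleDr Lp_scaleDl.

(* A norm over the scalar field R[i] takes its values in R[i]; this one is the
   embedding of the real p-norm. *)
Definition Lp_norm (u : Lp) : R[i] := (fine (cLnorm mu p (repr u)))%:C.

Lemma Lp_norm_pi (f : Lpfun) : Lp_norm (\pi_Lp f) = (fine (cLnorm mu p f))%:C.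
Proof.
congr (fine _)%:C; apply: ae_eq_cLnorm => //; try exact: Lpfun_measurable.
by have /eq_LpP := reprK (\pi_Lp f).
Qed.

Lemma Lp_normD u v : Lp_norm (u + v) <= Lp_norm u + Lp_norm v.
Proof.
rewrite -[u]reprK -[v]reprK -pi_LpD !Lp_norm_pi -rmorphD/= lecR.
rewrite -fineD ?cLnorm_fin_num// fine_le ?fin_numD ?cLnorm_fin_num//.
  exact: (cLnorm_fin_num (_ + _)).
exact: (le_cLnormD mu p1 (Lpfun_measurable _) (Lpfun_measurable _)).
Qed.

Lemma Lp_normZ (a : R[i]) u : Lp_norm (a *: u) = `|a| * Lp_norm u.
Proof.
rewrite -[u]reprK [a *: _]pi_scale !Lp_norm_pi.
have eqZ : cLnorm mu p (a *: repr u) = ((normc a)%:E * cLnorm mu p (repr u))%E.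
  exact: (cLnormZ mu p1 a (Lpfun_measurable _)).
by rewrite eqZ fineM ?cLnorm_fin_num// rmorphM.
Qed.

Lemma Lp_norm_eq0 u : Lp_norm u = 0 -> u = 0.
Proof.
rewrite -[u]reprK Lp_norm_pi => -[] /eqP; rewrite fine_eq0 ?cLnorm_fin_num//.
move=> /eqP /(cLnorm_eq0 p1 (Lpfun_measurable _)) u0.
by rewrite -[0](raddf0 \pi_Lp); apply/eq_LpP; apply: filterS u0.
Qed.

HB.instance Definition _ :=
  Lmodule_isNormed.Build R[i] Lp Lp_normD Lp_normZ Lp_norm_eq0.

End Lp.

Section CompositionOperator.
Context d (X : measurableType d) (R : realType).
Variables (mu : {measure set X -> \bar R}) (f : X -> X).

Record nonsingular_bimeasurable : Prop := {
  nsb_bij : bijective f;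
  nsb_measurable_image : forall B, measurable B -> measurable (f @` B);
  nsb_measurable_preimage : forall B, measurable B -> measurable (f @^-1` B);
  nsb_bound : exists2 c : R, 0 < c & forall B, measurable B ->
    (mu (f @^-1` B) <= c%:E * mu B)%E /\ (mu (f @` B) <= c%:E * mu B)%E }.

Hypothesis hf : nonsingular_bimeasurable.

Lemma nsb_measurable_fun : measurable_fun [set: X] f.
Proof.
by move=> _ B mB; rewrite setTI; exact: nsb_measurable_preimage.
Qed.

Lemma nsb_ae (P : X -> Prop) :
  {ae mu, forall x, P x} -> {ae mu, forall x, P (f x)}.
Proof.
move=> [N [mN N0 PN]]; have [c _ bc] := nsb_bound hf.
exists (f @^-1` N); split.
- exact: nsb_measurable_preimage.
- apply/eqP; rewrite eq_le measure_ge0 andbT.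
  by have [+ _] := bc _ mN; rewrite N0 mule0.
- by move=> x; exact: PN.
Qed.

Lemma cmeasurable_comp (g : X -> R[i]) : cmeasurable g -> cmeasurable (g \o f).
Proof.
move=> [gr gi]; split.
  exact: (measurableT_comp gr nsb_measurable_fun).
exact: (measurableT_comp gi nsb_measurable_fun).
Qed.

Variables (p : R) (p1 : 1 <= p).

Lemma cLnorm_comp : exists2 C : R, 0 <= C & forall g : X -> R[i],
  cmeasurable g -> (cLnorm mu p (g \o f) <= C%:E * cLnorm mu p g)%E.
Proof.
have [c c0 bc] := nsb_bound hf.
exists (c `^ p^-1); first exact: powR_ge0.
move=> g mg; pose h x := ((normc (g x)) `^ p)%R%:E.
have mh : measurable_fun [set: X] h by exact: measurable_normcX.
have h0 x : (0 <= h x)%E by rewrite lee_fin powR_ge0.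
pose k : {nonneg R} := NngNum (ltW c0).
rewrite !cLnormE -poweR_EFin -poweRM ?lee_fin ?(ltW c0)//; last first.
  by apply: integral_ge0 => x _; exact: h0.
have p0 : 0 < p by exact: lt_le_trans p1.
apply: gt0_ler_poweR; rewrite ?invr_ge0 ?(ltW p0)//.
- by rewrite in_itv/= leey andbT; apply: integral_ge0 => x _; exact: (h0 (f x)).
- rewrite in_itv/= leey andbT mule_ge0 ?lee_fin ?(ltW c0)//.
  by apply: integral_ge0 => x _; exact: h0.
have -> : (\int[mu]_x (normc ((g \o f) x) `^ p)%R%:E =
    \int[pushforward mu f]_x h x)%E.
  by rewrite ge0_integral_pushforward//; exact: nsb_measurable_fun.
rewrite -(ge0_integral_mscale mu measurableT k)//.
have mf := nsb_measurable_fun.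
apply: ge0_le_measure_integral => // B mB.
  by have [] := bc _ mB.
by move=> x _; exact: h0.
Qed.

Lemma comp_LpfunP (g : Lpfun mu p1) :
  (g \o f : X -> R[i]) \in Lpfun_pred mu p1.
Proof.
have [C C0 bC] := cLnorm_comp; apply/LpfunP; split.
  exact: cmeasurable_comp (Lpfun_measurable g).
rewrite (le_lt_trans (bC _ (Lpfun_measurable g)))//.
by rewrite lte_mul_pinfty// ltey_eq cLnorm_fin_num.
Qed.

Definition comp_Lpfun (g : Lpfun mu p1) : Lpfun mu p1 := LpFun (comp_LpfunP g).

(* T_f; the choice of representative is irrelevant by comp_opE. *)
Definition comp_op (u : Lp mu p1) : Lp mu p1 :=
  \pi_(Lp mu p1) (comp_Lpfun (repr u)).

Lemma comp_opE (g : Lpfun mu p1) :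
  comp_op (\pi_(Lp mu p1) g) = \pi_(Lp mu p1) (comp_Lpfun g).
Proof.
apply/eq_LpP; have /eq_LpP := reprK (\pi_(Lp mu p1) g).
exact: nsb_ae.
Qed.

Lemma comp_op_linear : linear comp_op.
Proof.
move=> a u v; rewrite -[u]reprK -[v]reprK.
have E (g h : Lpfun mu p1) : a *: \pi_(Lp mu p1) g + \pi_(Lp mu p1) h =
    \pi_(Lp mu p1) (a *: g + h).
  by rewrite pi_LpD -(pi_scale a).
by rewrite E !comp_opE E; apply/eq_LpP; exact: aeW.
Qed.

HB.instance Definition _ :=
  GRing.isLinear.Build R[i] (Lp mu p1) (Lp mu p1) *:%R comp_op comp_op_linear.

Lemma comp_op_bounded : exists C : R, forall u, `|comp_op u| <= C%:C * `|u|.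
Proof.
have [C C0 bC] := cLnorm_comp; exists C => u; rewrite -[u]reprK comp_opE.
rewrite -[leLHS]/(Lp_norm _) -[X in _ * X]/(Lp_norm _) !Lp_norm_pi.
rewrite -rmorphM lecR.
rewrite -lee_fin EFinM !fineK ?cLnorm_fin_num//.
exact: (bC _ (Lpfun_measurable _)).
Qed.

End CompositionOperator.
Arguments comp_op {d X R mu f} hf {p} p1 u.

(* The direct image f^k(A), k in Z; for k < 0 this is the preimage of A under
   the |k|-th iterate, i.e. its image under f^k when f is bijective. *)
Definition zimage (X : Type) (f : X -> X) (k : int) (A : set X) : set X :=
  match k with
  | Posz n => iter n f @` A
  | Negz n => iter n.+1 f @^-1` A
  end.

Section Dissipative.
Context d (X : measurableType d) (R : realType).
Variables (mu : {measure set X -> \bar R}) (f : X -> X) (W : set X).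
Local Open Scope ereal_scope.

Record dissipative : Prop := {
  dissipative_measurable : measurable W;
  dissipative_wandering : trivIset [set: int] (fun k => zimage f k W);
  dissipative_gt0 : 0 < mu W;
  dissipative_lty : mu W < +oo;
  dissipative_cover : \bigcup_(k in [set: int]) zimage f k W = [set: X] }.

Definition bounded_distortion := exists2 K : R, (0 < K)%R &
  forall (k : int) (B : set X), measurable B -> B `<=` W ->
    (K^-1)%:E * (mu (zimage f k W) * mu B) <= mu (zimage f k B) * mu W /\
    mu (zimage f k B) * mu W <= K%:E * (mu (zimage f k W) * mu B).

End Dissipative.

Definition separable (T : topologicalType) :=
  exists2 D : set T, countable D & dense D.

Section LinearDynamics.
Context (K : numFieldType) (Y : normedModType K).
Implicit Type T : Y -> Y.

Definition hypercyclic T := exists y, dense [set iter n T y | n in [set: nat]].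

End LinearDynamics.

Definition weakly_mixing (K : numFieldType) (Y : normedModType K)
    (T : Y -> Y) :=
  @hypercyclic K (Y * Y)%type (fun xy => (T xy.1, T xy.2)).

(* Main.v *)
Require Import Defs.
From mathcomp Require Import all_boot all_order all_algebra.
From mathcomp Require Import all_classical all_reals all_analysis.
From mathcomp.real_closed Require Import complex.
From mathcomp Require Import measurable_realfun zify lra.

(** Write m j for the mass of the block f^j(W). The blocks partition X, and
    nonsingularity of f gives m (j + k) <= c ^ |k| * m j. By this growth bound,
    (iii) only has to be known at j = 0, where it says that m n and m (- n) are
    simultaneously small for arbitrarily large n ([vanishing_masses],
    [vanishing_masses_ratioP]). The theorem is then the cycle
    (i) -> vanishing masses -> (ii) -> (i), the last step being a projection.

    From hypercyclicity to vanishing masses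
    ([hypercyclic_vanishing_masses]): some u in a dense orbit and some T^n u,
    with n large, are both close to the indicator of W. On most of W one has
    |u| >= 1/2, so |T^n u| >= 1/2 on the image of that large part of W under
    f^(-n); since this image misses W, where alone the target is nonzero,
    Markov's inequality makes its measure small, and bounded distortion
    carries the smallness over to the whole block f^(-n)(W). Exchanging u and
    T^n u treats the block f^n(W).

    From vanishing masses to weak mixing
    ([vanishing_masses_weakly_mixing]): the vector with dense orbit is written
    down explicitly. Truncating a dense sequence gives functions a_k, bounded by k
    and supported on the blocks of index at most k in absolute value, that
    still approximate every element of the dense sequence infinitely often.
    For rapidly increasing times s_k the translates a_k o f^(-s_k) have
    disjoint supports; let y be their sum. Then T^(s_k) y - a_k is bounded by
    l on a translate of the l-th zone, for each l <> k, and vanishes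
    elsewhere; the measures of these translates are controlled by the masses
    m (s_l - s_k), hence by m (s_l) or m (- s_k), which are as small as
    desired by the choice of the later time ([sparse_times_exists],
    [superposition]). Because the times s_k do not depend on the functions
    a_k, two sequences can be approximated simultaneously, which is weak
    mixing. *)

Set Implicit Arguments.
Unset Strict Implicit.
Unset Printing Implicit Defensive.

Import Order.TTheory GRing.Theory Num.Theory.
Import numFieldNormedType.Exports.
Import ComplexField.Normc.

Local Open Scope classical_set_scope.
Local Open Scope ring_scope.
Local Open Scope complex_scope.
Local Open Scope quotient_scope.

(** * Density in complex normed spaces *)

Lemma gt0_realE (R : realType) (e : R[i]) : 0 < e -> e = (complex.Re e)%:C.
Proof. by case: e => a b; rewrite ltcE /= => /andP[/eqP -> _]. Qed.

Section DenseBall.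
Context (R : realType) (Y : normedModType R[i]).

(** Balls of [Y] have radii in R[i]; a positive one is real, so density can be
    tested with real tolerances. *)
Lemma dense_normP (S : set Y) :
  dense S <-> forall u (e : R), 0 < e -> exists2 s, S s & `|u - s| < e%:C.
Proof.
split=> [dS u e e0|H O [u Ou] oO].
  have e0' : 0 < e%:C by rewrite ltcR.
  have ne : (ball u e%:C)° !=set0 by exists u; exact: nbhsx_ballx.
  have [s [bs Ss]] := dS _ ne (@open_interior _ _).
  exists s => //; have := interior_subset bs.
  by rewrite -ball_normE.
have /nbhs_ballP[e /= e0 be] : nbhs u O by exact: open_nbhs_nbhs.
have eE := gt0_realE e0.
have [|s Ss us] := H u (complex.Re e); first by rewrite -ltcR -eE.
exists s; split => //; apply: be.
by rewrite -ball_normE /= eE.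
Qed.

Lemma dense_prod_normP (S : set (Y * Y)) :
  dense S <-> forall u v (e : R), 0 < e ->
    exists2 s, S s & `|u - s.1| < e%:C /\ `|v - s.2| < e%:C.
Proof.
split=> [dS u v e e0|H O [[u v] Ou] oO].
  have e0' : 0 < e%:C by rewrite ltcR.
  have ne : (ball (u, v) e%:C)° !=set0 by exists (u, v); exact: nbhsx_ballx.
  have [s [bs Ss]] := dS _ ne (@open_interior _ _).
  exists s => //; have := interior_subset bs.
  by case; rewrite -ball_normE.
have /nbhs_ballP[e /= e0 be] : nbhs (u, v) O by exact: open_nbhs_nbhs.
have eE := gt0_realE e0.
have [|s Ss [us vs]] := H u v (complex.Re e); first by rewrite -ltcR -eE.
exists s; split => //; apply: be.
by split; rewrite -ball_normE /= eE.
Qed.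

End DenseBall.

Lemma iter_pair (Y : Type) (T : Y -> Y) n (yz : Y * Y) :
  iter n (fun xy => (T xy.1, T xy.2)) yz = (iter n T yz.1, iter n T yz.2).
Proof. by case: yz => y z; elim: n => //= n ->. Qed.

Lemma weakly_mixing_hypercyclic (R : realType) (Y : normedModType R[i])
  (T : Y -> Y) : weakly_mixing T -> hypercyclic T.
Proof.
move=> [[y z] /dense_prod_normP D]; exists y; apply/dense_normP => u e e0.
have [_ [n _ <-] [H _]] := D u u e e0; exists (iter n T y); first by exists n.
by move: H; rewrite iter_pair.
Qed.

(** * Integrals of p-th powers *)

Section PIntegral.
Context d (X : measurableType d) (R : realType) (mu : {measure set X -> \bar R}).
Context (p : R) (p1 : 1 <= p).

Lemma cmeasurableB (h k : X -> R[i]) : cmeasurable h -> cmeasurable k ->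
  cmeasurable (fun x => h x - k x).
Proof.
move=> mh mk; have := cmeasurableD mh (cmeasurableZ (-1) mk).
by congr cmeasurable; apply/funext => x; rewrite -[LHS]/(h x + -1 * k x) mulN1r.
Qed.

Lemma measurable_normc_ge (k : X -> R[i]) (t : R) : cmeasurable k ->
  measurable [set x | t <= normc (k x)].
Proof.
move=> /measurable_normc mk.
have := mk measurableT _ (measurable_itv `[t, +oo[); rewrite setTI.
by congr measurable; apply/seteqP; split => x; rewrite /= in_itv/= andbT.
Qed.

Let p0 : 0 < p. Proof. exact: lt_le_trans p1. Qed.

(** The p-th power of the p-norm. Working with it instead of the norm turns
    estimates on pieces with disjoint supports into sums. *)
Definition pint (h : X -> R[i]) : \bar R := (\int[mu]_x (normc (h x) `^ p)%:E)%E.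

Lemma pint_ge0 h : (0 <= pint h)%E.
Proof. by apply: integral_ge0 => x _; rewrite lee_fin powR_ge0. Qed.

Lemma cLnorm_lt h (e : R) : 0 < e ->
  (cLnorm mu p h < e%:E)%E = (pint h < (e `^ p)%:E)%E.
Proof.
move=> e0; rewrite cLnormE// -/(pint h).
have -> : e%:E = ((e `^ p)%:E `^ p^-1)%E.
  by rewrite poweR_EFin -powRrM mulfV ?gt_eqF// powRr1// ltW.
have := pint_ge0 h; case: (pint h) => [r||]//.
  rewrite lee_fin => r0; rewrite !poweR_EFin !lte_fin.
  have pV0 : 0 < p^-1 by rewrite invr_gt0.
  apply/idP/idP => [|H]; last by rewrite gt0_ltr_powR// nnegrE ?powR_ge0.
  apply: contraTT; rewrite -!leNgt => H.
  by rewrite ge0_ler_powR ?nnegrE ?powR_ge0// ltW.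
by move=> _; rewrite poweRyr// invr_neq0// gt_eqF.
Qed.

Lemma pint_Lpfun h : cmeasurable h -> (pint h < +oo)%E ->
  h \in Lpfun_pred mu p1.
Proof.
move=> mh hoo; apply/LpfunP; split => //; rewrite cLnormE//.
by rewrite poweR_lty.
Qed.

Lemma Lpfun_pint (h : Lpfun mu p1) : (pint h < +oo)%E.
Proof.
have /LpfunP[_] := Lpfun_valP h; rewrite cLnormE// -/(pint h).
by apply: lty_poweRy; rewrite invr_neq0// gt_eqF.
Qed.

Lemma pint_Chebyshev h (t : R) : cmeasurable h -> 0 < t ->
  ((t `^ p)%:E * mu [set x | (t <= normc (h x))%R] <= pint h)%E.
Proof.
move=> mh t0; have mA := measurable_normc_ge t mh.
rewrite -integral_cst//; have mhp := measurable_normcX p mh.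
apply: (@le_trans _ _ (\int[mu]_(x in [set x | (t <= normc (h x))%R])
    (normc (h x) `^ p)%:E)%E); last first.
  by apply: ge0_subset_integral => // x _; rewrite lee_fin powR_ge0.
apply: ge0_le_integral => //=.
- by move=> x _; rewrite lee_fin powR_ge0.
- exact: (measurable_funS measurableT).
move=> x tx; rewrite lee_fin ge0_ler_powR ?nnegrE ?normc_ge0 ?(ltW p0)//.
exact: ltW.
Qed.

Lemma Lp_norm_sub_lt (h k : Lpfun mu p1) (e : R) : 0 < e ->
  (`|\pi_(Lp mu p1) h - \pi_(Lp mu p1) k| < e%:C) =
  (pint (fun x => h x - k x)%R < (e `^ p)%:E)%E.
Proof.
move=> e0; rewrite -raddfB -[X in X < _]/(Lp_norm _) Lp_norm_pi ltcR.
by rewrite -lte_fin fineK ?cLnorm_fin_num// cLnorm_lt.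
Qed.

End PIntegral.

Section Cind.
Context d (X : measurableType d) (R : realType) (mu : {measure set X -> \bar R}).
Context (p : R) (p1 : 1 <= p).

Let p0 : 0 < p. Proof. exact: lt_le_trans p1. Qed.

Definition cindic (A : set X) (x : X) : R[i] := (\1_A x)%:C.

Lemma cindic1 A x : A x -> cindic A x = 1.
Proof. by move=> Ax; rewrite /cindic indicE mem_set. Qed.

Lemma cindic0 A x : ~ A x -> cindic A x = 0.
Proof. by move=> Ax; rewrite /cindic indicE memNset. Qed.

Lemma cindic_iff (A B : set X) x y : (A x <-> B y) -> cindic A x = cindic B y.
Proof.
move=> AB; have [Ax|Ax] := pselect (A x); first by rewrite !cindic1//; apply/AB.
by rewrite !cindic0// => /AB.
Qed.

Lemma cmeasurable_cindic A : measurable A -> cmeasurable (cindic A).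
Proof.
by move=> mA; split => /=; [exact: measurable_indic|exact: measurable_cst].
Qed.

Lemma normc_real (a : R) : normc a%:C = `|a|.
Proof. by rewrite /= expr0n addr0 sqrtr_sqr. Qed.

Lemma pint_cindic A : measurable A -> pint mu p (cindic A) = mu A.
Proof.
move=> mA; rewrite -[A in RHS]setIT -integral_indic//; apply: eq_integral => x _.
rewrite normc_real ger0_norm// indicE; case: (x \in A); first by rewrite powR1.
by rewrite powR0// gt_eqF.
Qed.

Lemma cindic_Lpfun A : measurable A -> (mu A < +oo)%E ->
  cindic A \in Lpfun_pred mu p1.
Proof.
move=> mA Aoo; apply: pint_Lpfun; first exact: cmeasurable_cindic.
by rewrite pint_cindic.
Qed.

End Cind.

Section PintSeries.
Context d (X : measurableType d) (R : realType) (mu : {measure set X -> \bar R}).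
Context (p : R) (p1 : 1 <= p).

Let p0 : 0 < p. Proof. exact: lt_le_trans p1. Qed.

(** The p-th power of |h| is dominated pointwise by the series of the
    l ^ p * 1_(A l): at a point where h does not vanish, one term of the series
    is already large enough. Integrating term by term leaves a geometric
    series. *)
Lemma pint_le_series (h : X -> R[i]) (A : nat -> set X) (e : R) :
  cmeasurable h -> (forall l, measurable (A l)) -> 0 <= e ->
  (forall x, h x != 0 -> exists2 l, A l x & normc (h x) <= l%:R) ->
  (forall l, (l%:R `^ p)%:E * mu (A l) <= (e / (2 ^ l.+1)%:R)%:E)%E ->
  (pint mu p h <= e%:E)%E.
Proof.
move=> mh mA e0 hA muA.
pose F l x : \bar R := ((l%:R `^ p)%:E * (\1_(A l) x)%:E)%E.
have F0 l x : (0 <= F l x)%E by rewrite mule_ge0// lee_fin ?powR_ge0// indicE.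
have mF l : measurable_fun [set: X] (F l).
  by apply/measurable_EFinP/measurable_funM => //; exact: measurable_indic.
apply: le_trans (epsilon_trick0 xpredT e0).
apply: (@le_trans _ _ (\int[mu]_x \sum_(l <oo) F l x)%E).
  apply: ge0_le_integral => //.
  - by move=> x _; rewrite lee_fin powR_ge0.
  - exact: measurable_normcX mh.
  - exact: ge0_emeasurable_sum.
  move=> x _; have [->|hx] := eqVneq (h x) 0.
    by rewrite normc0 powR0 ?gt_eqF//; exact: nneseries_ge0.
  have [l Al hl] := hA x hx.
  apply: (@le_trans _ _ (F l x)).
    rewrite /F indicE mem_set// mule1 lee_fin.
    by rewrite ge0_ler_powR ?nnegrE ?normc_ge0 ?(ltW p0).
  apply: le_trans (nneseries_lim_ge l.+1 _); last by [].
  by rewrite big_nat_recr//= leeDr// sume_ge0.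
rewrite integral_nneseries//; apply: lee_nneseries => [l _ _|l _].
  exact: integral_ge0.
rewrite ge0_integralZl_EFin ?powR_ge0//.
- by rewrite integral_indic// setIT.
- by apply/measurable_EFinP; exact: measurable_indic.
Qed.

End PintSeries.

(** * Blocks of a dissipative map *)

Section Zimage.
Context (X : Type) (f : X -> X) (f_bij : bijective f).

Lemma zimage0 (A : set X) : zimage f 0 A = A.
Proof. by rewrite eqEsubset; split=> [x [y Ay <-]|x Ax]//; exists x. Qed.

Lemma zimageS (j : int) (A : set X) : zimage f (j + 1) A = f @` zimage f j A.
Proof.
have [g fK gK] := f_bij.
case: j => [n|[|n]].
- by rewrite -[1]/(Posz 1) -PoszD addn1 /= image_comp.
- rewrite (_ : Negz 0 + 1 = 0)// zimage0 eqEsubset; split=> [x Ax|_ [x Ax <-]//].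
  by exists (g x); rewrite /= gK.
rewrite (_ : Negz n.+1 + 1 = Negz n); last by rewrite !NegzE; lia.
rewrite eqEsubset; split=> [x Ax|_ [x Ax <-]].
  by exists (g x); rewrite //= -iterS iterSr gK.
by move: Ax; rewrite /= -iterS iterSr.
Qed.

Lemma preimage_zimageS (j : int) (A : set X) :
  f @^-1` zimage f (j + 1) A = zimage f j A.
Proof.
rewrite zimageS eqEsubset; split=> [x [y Ay /(bij_inj f_bij) <-]//|x Ax].
by exists x.
Qed.

End Zimage.

Section Blocks.
Context d (X : measurableType d) (R : realType) (mu : {measure set X -> \bar R}).
Context (f : X -> X) (hf : nonsingular_bimeasurable mu f).
Context (W : set X) (hW : dissipative mu f W).

Let f_bij := nsb_bij hf.

(** The index of the f^k(W) that contains x. When f is dissipative these sets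
    form a partition, so that the index is unique and the default value 0 is
    never used. *)
Definition block (x : X) : int := xget 0 [set k | zimage f k W x].

Lemma blockP x : zimage f (block x) W x.
Proof.
have : [set: X] x by [].
rewrite -(dissipative_cover hW) => -[k _ kx].
exact: (@xgetPex _ 0 [set k | zimage f k W x] (ex_intro _ k kx)).
Qed.

Lemma zimage_blockE (j : int) : zimage f j W = [set x | block x = j].
Proof.
rewrite eqEsubset; split=> [x jx|x <-]; last exact: blockP.
by apply: (dissipative_wandering hW) => //; exists x; split => //; exact: blockP.
Qed.

Lemma block_W x : W x <-> block x = 0.
Proof.
have : zimage f 0 W x <-> block x = 0 by rewrite zimage_blockE.
by rewrite zimage0.
Qed.

Lemma block_map x : block (f x) = block x + 1.
Proof.
have : zimage f (block x + 1) W (f x).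
  by rewrite zimageS//; exists x => //; exact: blockP.
by rewrite zimage_blockE.
Qed.

Lemma block_iter n x : block (iter n f x) = block x + n%:Z.
Proof.
elim: n => [|n IH]; first by rewrite addr0.
by rewrite iterS block_map IH -addrA -PoszD addn1.
Qed.

Lemma measurable_zimage j B : measurable B -> measurable (zimage f j B).
Proof.
case: j => n mB.
  elim: n => [|n IH]; first by rewrite zimage0.
  rewrite -addn1 PoszD zimageS//.
  exact: (nsb_measurable_image hf).
elim: n => [|n IH]; first exact: (nsb_measurable_preimage hf).
rewrite -(preimage_zimageS f_bij) (_ : Negz n.+1 + 1 = Negz n).
  exact: (nsb_measurable_preimage hf).
by rewrite !NegzE; lia.
Qed.

Lemma measurable_block (P : int -> Prop) : measurable [set x | P (block x)].
Proof.
have -> : [set x | P (block x)] =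
    \bigcup_(j : int) (if `[< P j >] then zimage f j W else set0).
  rewrite eqEsubset; split=> [x Px|x [j _]].
    by exists (block x) => //=; rewrite asboolT//; exact: blockP.
  by case: asboolP => // Pj; rewrite zimage_blockE => /= ->.
apply: countable_bigcupT_measurable => [|j]; first exact: countableP.
case: ifP => // _; exact: measurable_zimage (dissipative_measurable hW).
Qed.

(** A function given by a different measurable formula on each block is
    measurable, because there are countably many blocks. *)
Lemma measurable_fun_block d' (Y : measurableType d') (F : int -> X -> Y) :
  (forall j, measurable_fun [set: X] (F j)) ->
  measurable_fun [set: X] (fun x => F (block x) x).
Proof.
move=> mF _ B mB; rewrite setTI.
have -> : (fun x => F (block x) x) @^-1` B =
    \bigcup_(j : int) ([set x | block x = j] `&` F j @^-1` B).
  rewrite eqEsubset; split=> [x Bx|x [j _ [<-]]]//.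
  by exists (block x).
apply: countable_bigcupT_measurable => [|j]; first exact: countableP.
apply: measurableI; first exact: (measurable_block (fun k => k = j)).
by rewrite -[X in measurable X]setTI; exact: mF.
Qed.

Definition mass (j : int) : R := fine (mu (zimage f j W)).

(** Nonsingularity compares the masses of neighbouring blocks both ways, so
    positivity and finiteness spread from W to every block. *)
Lemma mass_bounds : exists2 c : R, 1 <= c & forall j,
  [/\ (0 < mu (zimage f j W) < +oo)%E,
   (mu (zimage f (j + 1) W) <= c%:E * mu (zimage f j W))%E &
   (mu (zimage f j W) <= c%:E * mu (zimage f (j + 1) W))%E].
Proof.
have [c0 c0_gt0 bc] := nsb_bound hf.
pose c := Num.max c0 1.
have cc : (c0%:E <= c%:E)%E by rewrite lee_fin le_max lexx.
have mW j := measurable_zimage j (dissipative_measurable hW).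
have up j : (mu (zimage f (j + 1) W) <= c%:E * mu (zimage f j W))%E.
  rewrite zimageS//; apply: le_trans (bc _ (mW j)).2 _.
  by rewrite lee_wpmul2r.
have dn j : (mu (zimage f j W) <= c%:E * mu (zimage f (j + 1) W))%E.
  rewrite -{1}(preimage_zimageS f_bij); apply: le_trans (bc _ (mW _)).1 _.
  by rewrite lee_wpmul2r.
have c_gt0 : 0 < c by rewrite lt_max ltr01 orbT.
have step j : ((0 < mu (zimage f j W) < +oo) =
    (0 < mu (zimage f (j + 1) W) < +oo))%E.
  apply/idP/idP => /andP[a b]; apply/andP; split.
  - have := lt_le_trans a (dn j).
    by rewrite -{1}(mule0 c%:E) lte_pmul2l// lte_fin.
  - by rewrite (le_lt_trans (up j))// lte_mul_pinfty// lee_fin ltW.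
  - have := lt_le_trans a (up j).
    by rewrite -{1}(mule0 c%:E) lte_pmul2l// lte_fin.
  - by rewrite (le_lt_trans (dn j))// lte_mul_pinfty// lee_fin ltW.
exists c; first by rewrite le_max lexx orbT.
move=> j; split => //.
have H0 : (0 < mu (zimage f 0 W) < +oo)%E.
  by rewrite zimage0 (dissipative_gt0 hW) (dissipative_lty hW).
case: j => n.
  by elim: n => // n; rewrite step -PoszD addn1.
elim: n => [|n IH]; rewrite step; first by rewrite (_ : Negz 0 + 1 = 0).
by rewrite (_ : Negz n.+1 + 1 = Negz n)//; rewrite !NegzE; lia.
Qed.

Lemma massE j : mu (zimage f j W) = (mass j)%:E.
Proof.
have [c _ /(_ j)[/andP[a b] _ _]] := mass_bounds.
by rewrite fineK// ge0_fin_numE// ltW.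
Qed.

Lemma mass_gt0 j : 0 < mass j.
Proof.
have [c _ /(_ j)[/andP[a b] _ _]] := mass_bounds.
by rewrite -lte_fin -massE.
Qed.

(** Moving by k blocks costs a factor that depends on k only; thus the masses
    of the blocks around f^n(W) are controlled by that of f^n(W) itself. *)
Lemma mass_growth : exists2 c : R, 1 <= c & forall j k,
  mass (j + k) <= c ^+ `|k|%N * mass j.
Proof.
have [c c1 H] := mass_bounds; exists c => // j k.
have c0 : 0 <= c by exact: le_trans c1.
have up i : mass (i + 1) <= c * mass i.
  by have [_] := H i; rewrite !massE -EFinM lee_fin.
have dn i : mass i <= c * mass (i + 1).
  by have [_ _] := H i; rewrite !massE -EFinM lee_fin.
case: k => n.
  elim: n => [|n IH]; first by rewrite addr0 mul1r.
  rewrite -addn1 PoszD addrA (le_trans (up _))//= addn1 exprS -mulrA.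
  by rewrite ler_wpM2l.
rewrite NegzE abszN absz_nat; elim: n.+1 => [|m IH].
  by rewrite subr0 mul1r.
rewrite (le_trans (dn _))// exprS -mulrA ler_wpM2l//.
by rewrite (_ : j - m.+1%:Z + 1 = j - m%:Z)//; lia.
Qed.

End Blocks.

(** * Iterates of the composition operator *)

Section CompIter.
Context d (X : measurableType d) (R : realType) (mu : {measure set X -> \bar R}).
Context (f : X -> X) (hf : nonsingular_bimeasurable mu f).
Context (p : R) (p1 : 1 <= p).
Local Notation T := (comp_op hf p1).

Lemma iter_comp_op n (h : Lpfun mu p1) :
  iter n T (\pi_(Lp mu p1) h) =
  \pi_(Lp mu p1) (iter n (comp_Lpfun hf (p1 := p1)) h).
Proof. by elim: n => //= n ->; rewrite comp_opE. Qed.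

Lemma iter_comp_LpfunE n (h : Lpfun mu p1) x :
  iter n (comp_Lpfun hf (p1 := p1)) h x = h (iter n f x).
Proof. by elim: n x => //= n IH x; rewrite IH -iterS iterSr. Qed.

Lemma cmeasurable_iter n (h : X -> R[i]) : cmeasurable h ->
  cmeasurable (fun x => h (iter n f x)).
Proof.
move=> mh; elim: n => //= n IH.
have := cmeasurable_comp hf IH; congr cmeasurable.
by apply/funext => x /=; rewrite -iterS iterSr.
Qed.

Lemma iter_comp_op_lipschitz n : exists2 C : R, 0 < C & forall u v,
  `|iter n T u - iter n T v| <= C%:C * `|u - v|.
Proof.
have [C HC] := comp_op_bounded hf p1.
pose C' := Num.max C 1.
have C'0 : 0 < C' by rewrite lt_max ltr01 orbT.
have HC' u : `|T u| <= C'%:C * `|u|.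
  apply: le_trans (HC u) _; rewrite ler_wpM2r// lecR.
  by rewrite le_max lexx.
exists (C' ^+ n); first exact: exprn_gt0.
move=> u v; elim: n => [|n IH]; first by rewrite expr0 mul1r.
rewrite !iterS -raddfB (le_trans (HC' _))// exprS rmorphM/= -mulrA.
by rewrite ler_wpM2l// lecR ltW.
Qed.

End CompIter.

(** * Simultaneously vanishing masses *)

(** Dependent choice in which the k-th choice depends on the previous
    one and on k. *)
Lemma recursive_choice (Q : nat -> nat -> nat -> Prop) :
  (forall k a, exists n, Q k a n) ->
  exists s : nat -> nat, forall k, Q k (s k) (s k.+1).
Proof.
move=> H; have /choice[F HF] (ka : nat * nat) := H ka.1 ka.2.
pose s := fix s k := if k is k'.+1 then F (k', s k') else 0%N.
by exists s => k; exact: (HF (k, s k)).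
Qed.

Section Ratio.
Context d (X : measurableType d) (R : realType) (mu : {measure set X -> \bar R}).
Context (f : X -> X) (hf : nonsingular_bimeasurable mu f).
Context (W : set X) (hW : dissipative mu f W).
Local Notation mass := (mass mu f W).

(** Condition (iii) freed from the base index j and from the sequence: the two
    ends of the orbit of W become small at the same times. *)
Definition vanishing_masses := forall (e : R) (N : nat), 0 < e ->
  exists n : nat, [/\ (N <= n)%N, mass n <= e & mass (- n%:Z) <= e].

Lemma mass_ratioE i j :
  (mu (zimage f i W) / mu (zimage f j W))%E = (mass i / mass j)%:E.
Proof. by rewrite !(massE hf hW) inver gt_eqF// (mass_gt0 hf hW). Qed.

(** The second limit of (iii) is the first one for the inverse ratio. *)
Lemma cvg_ratio_pinfty (u : nat -> int) j :
  ((mu (zimage f j W) / mu (zimage f (u k) W))%E @[k --> \oo] --> +oo%E) <->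
  (mass (u k) / mass j @[k --> \oo] --> 0).
Proof.
under eq_cvg do rewrite mass_ratioE.
rewrite cvgeryP -gtr0_cvgV0.
  under eq_cvg do rewrite /= invf_div.
  by [].
by apply: nearW => k; rewrite divr_gt0// (mass_gt0 hf hW).
Qed.

Lemma cvg_ratio0 (u : nat -> int) j :
  ((mu (zimage f (u k) W) / mu (zimage f j W))%E @[k --> \oo] --> 0%E) <->
  (mass (u k) / mass j @[k --> \oo] --> 0).
Proof.
under eq_cvg do rewrite mass_ratioE.
split=> [/fine_cvgP[]//|H]; apply/fine_cvgP; split => //.
exact: nearW.
Qed.

(** Passing from the base index 0 to an arbitrary one multiplies the masses by
    a bounded factor, by [mass_growth]. *)
Lemma cvg_mass_ratio0 (u : nat -> int) j i :
  (forall k, mass (u k) <= k.+1%:R^-1) ->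
  mass (u k + i) / mass j @[k --> \oo] --> 0.
Proof.
move=> um; have [c c1 gc] := mass_growth hf hW.
apply: (@squeeze_cvgr _ _ _ _ (cst 0)
  (fun k => (c ^+ `|i|%N / mass j) * harmonic k)).
- apply: nearW => k; rewrite divr_ge0 ?(ltW (mass_gt0 hf hW _))//=.
  rewrite mulrAC ler_pM2r ?invr_gt0 ?(mass_gt0 hf hW)//.
  rewrite (le_trans (gc _ _))// ler_wpM2l// exprn_ge0//.
  exact: le_trans c1.
- exact: cvg_cst.
rewrite -[X in _ --> X](mulr0 (c ^+ `|i|%N / mass j)).
by apply: cvgMr; exact: cvg_harmonic.
Qed.

Lemma vanishing_masses_ratioP : vanishing_masses <->
  exists n : nat -> nat,
    [/\ forall k, (0 < n k)%N,
        {homo n : k l / (k < l)%N} &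
        forall j : int,
          ((mu (zimage f (j - (n k)%:Z) W) / mu (zimage f j W))%E
             @[k --> \oo] --> 0%E) /\
          ((mu (zimage f j W) / mu (zimage f (j + (n k)%:Z) W))%E
             @[k --> \oo] --> +oo%E)].
Proof.
split=> [V|[n [n0 nlt Hn]] e N e0].
  have [k a|s Hs] := @recursive_choice (fun k a n => [/\ (a < n)%N,
      mass n <= k.+1%:R^-1 & mass (- n%:Z) <= k.+1%:R^-1]).
    have [|n [an n1 n2]] := V k.+1%:R^-1 a.+1; first by rewrite invr_gt0.
    by exists n.
  exists (fun k => s k.+1); split.
  - by move=> k; have [sk _ _] := Hs k; exact: leq_ltn_trans sk.
  - apply: homo_ltn => [|k]; first exact: ltn_trans.
    by have [] := Hs k.+1.
  - move=> j; rewrite (cvg_ratio0 (fun k => j - (s k.+1)%:Z)).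
    rewrite (cvg_ratio_pinfty (fun k => j + (s k.+1)%:Z)).
    under eq_cvg do rewrite addrC.
    under [X in _ /\ X]eq_cvg do rewrite addrC.
    split.
    + by apply: (cvg_mass_ratio0 (u := fun k => - (s k.+1)%:Z)) => k;
        have [] := Hs k.
    + by apply: (cvg_mass_ratio0 (u := fun k => (s k.+1)%:Z)) => k;
        have [] := Hs k.
have [H1 H2] := Hn 0.
have m0 := mass_gt0 hf hW 0.
have em : 0 < e / mass 0 by rewrite divr_gt0.
move/(cvg_ratio0 (fun k => 0 - (n k)%:Z))/cvgr0_norm_le/(_ _ em) : H1.
move=> [N1 _ H1].
move/(cvg_ratio_pinfty (fun k => 0 + (n k)%:Z))/cvgr0_norm_le/(_ _ em) : H2.
move=> [N2 _ H2].
pose k := (N1 + N2 + N)%N.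
have nk : (k <= n k)%N.
  elim: k => // k IH; apply: leq_ltn_trans IH _; exact: nlt.
exists (n k); split; first by apply: leq_trans nk; rewrite /k; lia.
- have := H2 k; rewrite /= add0r ger0_norm ?divr_ge0 ?(ltW (mass_gt0 hf hW _))//.
  by rewrite ler_pM2r ?invr_gt0//; apply; rewrite /k; lia.
- have := H1 k; rewrite /= add0r ger0_norm ?divr_ge0 ?(ltW (mass_gt0 hf hW _))//.
  by rewrite ler_pM2r ?invr_gt0//; apply; rewrite /k; lia.
Qed.

End Ratio.

(** * Hypercyclicity forces the masses to vanish *)

Section Recurrence.
Context d (X : measurableType d) (R : realType) (mu : {measure set X -> \bar R}).
Context (f : X -> X) (hf : nonsingular_bimeasurable mu f).
Context (W : set X) (hW : dissipative mu f W).
Context (p : R) (p1 : 1 <= p).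
Local Notation mass := (mass mu f W).

Let p0 : 0 < p. Proof. exact: lt_le_trans p1. Qed.
Let mW := dissipative_measurable hW.

Lemma measure_W : mu W = (mass 0)%:E.
Proof. by rewrite -(massE hf hW) zimage0. Qed.

(** The threshold 1/2 separates the values of a function close to 1 on W from
    those of a function close to 0 off W. *)
Lemma markov_half (k : X -> R[i]) (t : R) : cmeasurable k ->
  (pint mu p k < (2^-1 `^ p * t)%:E)%E ->
  (mu [set x | (2^-1 <= normc (k x))%R] < t%:E)%E.
Proof.
move=> mk kt; have h0 : 0 < 2^-1 `^ p :> R by rewrite powR_gt0.
have h := @pint_Chebyshev _ _ _ mu _ p1 k _ mk (_ : 0 < 2^-1).
have := le_lt_trans (h _) kt; rewrite EFinM lte_pmul2l ?lte_fin//.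
by apply; rewrite invr_gt0.
Qed.

(** Where |k| < 1/2 inside W, the function k differs from the indicator by more
    than 1/2; this happens on less than half of W. *)
Lemma near_cindicW_large (k : X -> R[i]) (t : R) : cmeasurable k ->
  t <= mass 0 / 2 ->
  (mu [set x | (2^-1 <= normc (k x - cindic R W x))%R] < t%:E)%E ->
  ((mass 0 / 2)%:E <= mu (W `&` [set x | (2^-1 <= normc (k x))%R]))%E.
Proof.
move=> mk tm kt; set B := W `&` _.
have mB : measurable B by apply: measurableI => //; exact: measurable_normc_ge.
set N := (X in mu X) in kt.
have mN : measurable N.
  exact: measurable_normc_ge (cmeasurableB mk (cmeasurable_cindic R mW)).
have WBN : W `<=` B `|` N.
  move=> x Wx; have [kx|kx] := leP 2^-1 (normc (k x)); [by left; split|right].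
  rewrite /N/= cindic1//.
  have := le_normcD (k x) (1 - k x).
  rewrite addrC subrK normc1 -(normcN (1 - _)) opprB => H.
  by lra.
have : (mu W <= mu B + mu N)%E.
  apply: le_trans (measureU2 mu mB mN).
  by apply: le_measure => //; rewrite inE//; exact: measurableU.
move=> WN; rewrite leNgt; apply/negP => Bm.
move: WN; apply/negP; rewrite -ltNge measure_W.
apply: lt_le_trans (lteD Bm kt) _.
by rewrite -EFinD lee_fin; lra.
Qed.

(** Bounded distortion in the form used here: if the image under f^k of at least
    half of W is small, then the image of all of W is small. *)
Lemma distorted_mass_le (K t : R) (k : int) (B : set X) : 0 < K ->
  ((K^-1)%:E * (mu (zimage f k W) * mu B) <= mu (zimage f k B) * mu W)%E ->
  ((mass 0 / 2)%:E <= mu B)%E -> (mu (zimage f k B) <= t%:E)%E ->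
  mass k <= 2 * K * t.
Proof.
move=> K0 dist mB kB; have m0 := mass_gt0 hf hW 0.
have H := le_trans dist (lee_wpmul2r (measure_ge0 _ _) kB).
have : ((K^-1)%:E * ((mass k)%:E * (mass 0 / 2)%:E) <= t%:E * (mass 0)%:E)%E.
  rewrite -measure_W; apply: le_trans H; rewrite (massE hf hW).
  rewrite lee_wpmul2l ?lee_fin ?invr_ge0 ?(ltW K0)//.
  by rewrite lee_wpmul2l// lee_fin ltW// (mass_gt0 hf hW).
rewrite -!EFinM lee_fin ler_pdivrMl// !mulrA ler_pdivrMr//.
rewrite [K * t * _ * _]mulrAC ler_pM2r//.
by move=> kt; rewrite (le_trans kt)// [K * t * 2]mulrC mulrA.
Qed.

(** Being close to the indicator of W, the function h is large on most of W,
    hence h o f^n is large on most of f^(-n)(W), by distortion; but f^(-n)(W)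
    misses W, and off W the function h o f^n is close to 0. So f^(-n)(W) has
    small mass. Exchanging h and h o f^n gives the bound for f^n(W). *)
Lemma mass_le_of_return (K t : R) (h : X -> R[i]) (n : nat) : 0 < K ->
  (forall (k : int) (B : set X), measurable B -> B `<=` W ->
    ((K^-1)%:E * (mu (zimage f k W) * mu B) <= mu (zimage f k B) * mu W)%E) ->
  cmeasurable h -> (0 < n)%N -> t <= mass 0 / 2 ->
  (pint mu p (fun x => h x - cindic R W x)%R < (2^-1 `^ p * t)%:E)%E ->
  (pint mu p (fun x => h (iter n f x) - cindic R W x)%R <
    (2^-1 `^ p * t)%:E)%E ->
  mass n <= 2 * K * t /\ mass (- n%:Z) <= 2 * K * t.
Proof.
move=> K0 dist mh n0 tm h1 h2.
have mhn := cmeasurable_iter hf n mh.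
have mind := cmeasurable_cindic R mW.
have m1 := markov_half (cmeasurableB mh mind) h1.
have m2 := markov_half (cmeasurableB mhn mind) h2.
have notW x : W x -> ~ W (iter n f x).
  rewrite !(block_W hW) (block_iter hf hW) => -> /eqP.
  by rewrite add0r eqz_nat gtn_eqF.
split.
- pose B := W `&` [set x | 2^-1 <= normc (h (iter n f x))].
  have mB : measurable B.
    by apply: measurableI => //; exact: measurable_normc_ge.
  apply: (@distorted_mass_le K t n B) => //.
  + by apply: dist => //; exact: subIsetl.
  + exact: near_cindicW_large m2.
  apply/ltW/(le_lt_trans _ m1); apply: le_measure; rewrite ?inE.
  + exact: (measurable_zimage hf).
  + exact: (measurable_normc_ge _ (cmeasurableB mh mind)).
  by move=> _ [x [Wx hx] <-]; rewrite /= cindic0 ?subr0//; exact: notW.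
- pose B := W `&` [set x | 2^-1 <= normc (h x)].
  have mB : measurable B.
    by apply: measurableI => //; exact: measurable_normc_ge.
  have zB : zimage f (- n%:Z) B = iter n f @^-1` B.
    by case: n n0 {h2 mhn m2 notW}.
  apply: (@distorted_mass_le K t _ B) => //.
  + by apply: dist => //; exact: subIsetl.
  + exact: near_cindicW_large m1.
  apply/ltW/(le_lt_trans _ m2); apply: le_measure; rewrite ?inE.
  + exact: (measurable_zimage hf).
  + exact: (measurable_normc_ge _ (cmeasurableB mhn mind)).
  rewrite zB => x [Wx hx]; rewrite /= cindic0 ?subr0//.
  by move=> /notW.
Qed.

(** Two distant return times of the orbit to a neighbourhood of the indicator of
    W are needed. Density alone does not make the second time large; it is obtained
    as M + b with M large, where T^b y approximates the indicator of f^M(W),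
    which T^M maps to the indicator of W. *)
Lemma hypercyclic_vanishing_masses :
  bounded_distortion mu f W -> hypercyclic (comp_op hf p1) ->
  vanishing_masses mu f W.
Proof.
move=> [K K0 dist] [y /dense_normP Dy] e N e0.
have m0 := mass_gt0 hf hW 0.
pose t := Num.min (mass 0 / 2) (e / (2 * K)).
have t0 : 0 < t by rewrite lt_min !divr_gt0// mulr_gt0.
(* The radius for which r ^ p is the bound required by [mass_le_of_return]. *)
pose r := 2^-1 * t `^ p^-1.
have r0 : 0 < r by rewrite mulr_gt0// powR_gt0.
have rp : r `^ p = 2^-1 `^ p * t.
  by rewrite powRM ?invr_ge0// ?powR_ge0// -powRrM mulVf ?gt_eqF// powRr1 ?ltW.
have fin_zW k : (mu (zimage f k W) < +oo)%E by rewrite (massE hf hW) ltry.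
pose one k : Lpfun mu p1 :=
  LpFun (cindic_Lpfun p1 (measurable_zimage hf k mW) (fin_zW k)).
have [_ [a _ <-] Ha] := Dy (\pi_(Lp mu p1) (one 0)) r r0.
have [M aM] : exists M, (a + N < M)%N by exists (a + N).+1.
have [C C0 lipC] := iter_comp_op_lipschitz hf p1 M.
have [_ [b _ <-] Hb] := Dy (\pi_(Lp mu p1) (one M)) (r / C) (divr_gt0 r0 C0).
have TM : iter M (comp_op hf p1) (\pi_(Lp mu p1) (one M)) =
    \pi_(Lp mu p1) (one 0).
  rewrite iter_comp_op; apply/eq_LpP; apply: aeW => x.
  rewrite iter_comp_LpfunE; apply: cindic_iff.
  rewrite !(zimage_blockE hW) /= (block_iter hf hW).
  by split=> H; lia.
have Hb' : `|\pi_(Lp mu p1) (one 0) - iter (M + b) (comp_op hf p1) y| < r%:C.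
  rewrite iterD -TM; apply: le_lt_trans (lipC _ _) _.
  have -> : r%:C = C%:C * (r / C)%:C.
    by rewrite -rmorphM/= mulrCA divff ?mulr1// gt_eqF.
  by rewrite ltr_pM2l// ltcR.
pose h : Lpfun mu p1 := repr (iter a (comp_op hf p1) y).
pose n := (M + b - a)%N.
have n0 : (0 < n)%N by rewrite /n; lia.
have Nn : (N <= n)%N by rewrite /n; lia.
have Ea : iter a (comp_op hf p1) y = \pi_(Lp mu p1) h by rewrite reprK.
have Eb : iter (M + b) (comp_op hf p1) y =
    \pi_(Lp mu p1) (iter n (comp_Lpfun hf (p1 := p1)) h).
  rewrite -iter_comp_op -Ea -iterD; congr (iter _ _ _).
  by rewrite /n; lia.
move: Ha Hb'; rewrite Ea Eb distrC Lp_norm_sub_lt// distrC Lp_norm_sub_lt// rp.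
have one0E x : one 0 x = cindic R W x by rewrite -[W in RHS](zimage0 f).
under eq_fun do rewrite one0E; move=> Ha.
under eq_fun do rewrite one0E iter_comp_LpfunE; move=> Hb'.
exists n; have [|||] := @mass_le_of_return K t h n K0 _ _ n0 _ Ha Hb'.
- by move=> k B mB BW; have [] := dist k B mB BW.
- exact: Lpfun_measurable.
- by rewrite ge_min lexx.
have te : 2 * K * t <= e.
  by rewrite mulrC -ler_pdivlMr ?mulr_gt0// ge_min lexx orbT.
by move=> n1 n2; split => //; [exact: le_trans n1 te|exact: le_trans n2 te].
Qed.

End Recurrence.

(** * Truncation to finitely many blocks *)

Section Zones.
Context d (X : measurableType d) (R : realType) (mu : {measure set X -> \bar R}).
Context (f : X -> X) (hf : nonsingular_bimeasurable mu f).
Context (W : set X) (hW : dissipative mu f W).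
Local Notation mass := (mass mu f W).
Local Notation block := (block f W).

Definition zone (i : int) (l : nat) : set X := [set x | (`|block x - i| <= l)%N].

Lemma measurable_zone i l : measurable (zone i l).
Proof. exact: (measurable_block hf hW (fun j => (`|j - i| <= l)%N)). Qed.

Lemma zone_measure_le (c : R) (i : int) (l : nat) : 1 <= c ->
  (forall j k, mass (j + k) <= c ^+ `|k|%N * mass j) ->
  (mu (zone i l) <= (l.*2.+1%:R * c ^+ l * mass i)%:E)%E.
Proof.
move=> c1 gc; pose B (t : nat) := zimage f (i - l%:Z + t%:Z) W.
have mB t : measurable (B t).
  by apply: (measurable_zimage hf); exact: dissipative_measurable hW.
have zB : zone i l `<=` \big[setU/set0]_(t < l.*2.+1) B t.
  move=> x zx; rewrite -bigcup_mkord; exists (absz (block x - i + l%:Z)) => /=.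
    by move: zx; rewrite /zone/=; lia.
  by rewrite /B (zimage_blockE hW)/=; move: zx; rewrite /zone/=; lia.
apply: (@le_trans _ _ (mu (\big[setU/set0]_(t < l.*2.+1) B t))).
  apply: le_measure => //; rewrite inE; first exact: measurable_zone.
  exact: bigsetU_measurable.
apply: le_trans (Boole_inequality mu (fun t _ => mB t)) _.
apply: (@le_trans _ _ (\sum_(t < l.*2.+1) (c ^+ l * mass i)%:E)%E).
  apply: lee_sum => -[t tl] _ /=; rewrite (massE hf hW) lee_fin -addrA.
  apply: le_trans (gc _ _) _; rewrite ler_wpM2r ?(ltW (mass_gt0 hf hW _))//.
  by rewrite ler_weXn2l//; lia.
by rewrite sumEFin sumr_const card_ord -[_ *+ _]mulr_natl mulrA.
Qed.

End Zones.

Section Truncation.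
Context d (X : measurableType d) (R : realType) (mu : {measure set X -> \bar R}).
Context (f : X -> X) (hf : nonsingular_bimeasurable mu f).
Context (W : set X) (hW : dissipative mu f W).
Context (p : R) (p1 : 1 <= p).
Local Notation block := (block f W).

Let p0 : 0 < p. Proof. exact: lt_le_trans p1. Qed.

Definition trunc (k : nat) (u : X -> R[i]) (x : X) : R[i] :=
  if (`|block x| <= k)%N && (normc (u x) <= k%:R) then u x else 0.

Lemma normc_trunc_le k u x : normc (trunc k u x) <= k%:R.
Proof. by rewrite /trunc; case: ifPn => [/andP[]//|_]; rewrite normc0. Qed.

Lemma trunc_support k u x : trunc k u x != 0 -> (`|block x| <= k)%N.
Proof. by rewrite /trunc; case: ifPn => [/andP[]//|_]; rewrite eqxx. Qed.

Lemma cmeasurable_trunc k u : cmeasurable u -> cmeasurable (trunc k u).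
Proof.
move=> mu_; pose b x := (`|block x| <= k)%N && (normc (u x) <= k%:R).
have mb : measurable_fun [set: X] b.
  apply: measurable_and.
    apply: (measurable_fun_bool true); rewrite setTI.
    exact: (measurable_block hf hW (fun j => (`|j| <= k)%N)).
  by apply: measurable_fun_ler => //; exact: measurable_normc.
have mif (F : R[i] -> R) : measurable_fun [set: X] (F \o u) ->
    measurable_fun [set: X] (fun x => F (trunc k u x)).
  move=> mF; have -> : (fun x => F (trunc k u x)) =
      (fun x => if b x then F (u x) else F 0).
    by apply/funext => x; rewrite /trunc -/(b x); case: (b x).
  exact: measurable_fun_ifT.
by case: mu_ => mr mi; split; exact: mif.
Qed.

(** By dominated convergence, since each point belongs to all the sets of
    truncation from some k on. *)
Lemma trunc_dense (u : Lpfun mu p1) (e : R) : 0 < e ->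
  exists N, forall k, (N <= k)%N ->
    (pint mu p (fun x => u x - trunc k u x)%R < e%:E)%E.
Proof.
move=> e0; have mu_ := Lpfun_measurable u.
pose h k x : \bar R := (normc (u x - trunc k u x) `^ p)%:E.
have [] := @dominated_convergence _ _ _ mu [set: X] measurableT h (cst 0)%E
  (fun x => (normc (u x) `^ p)%:E).
- move=> k; apply: measurable_normcX.
  exact: (cmeasurableB mu_ (cmeasurable_trunc k mu_)).
- exact: measurable_cst.
- apply: aeW => x _; apply: cvg_near_cst.
  exists (`|block x| + (Num.truncn (normc (u x))).+1)%N => //= k /= kx.
  rewrite /h /trunc ifT ?subrr ?normc0 ?powR0 ?gt_eqF//; apply/andP; split.
    by lia.
  rewrite (le_trans (ltW (truncnS_gt _)))// ler_nat.
  exact: leq_trans (leq_addl _ _) kx.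
- apply/integrableP; split; first exact: measurable_normcX mu_.
  under eq_integral do rewrite gee0_abs ?lee_fin ?powR_ge0//.
  exact: Lpfun_pint.
- apply: aeW => x k _; rewrite gee0_abs ?lee_fin ?powR_ge0//.
  rewrite ge0_ler_powR ?nnegrE ?normc_ge0 ?(ltW p0)// /trunc.
  by case: ifP; rewrite ?subrr ?normc0 ?subr0 ?normc_ge0.
move=> _ _; rewrite /= integral_cst// mul0e => H.
have [N _ HN] : \forall k \near \oo,
    (pint mu p (fun x => u x - trunc k u x)%R < e%:E)%E.
  have e0' : (0 < e%:E)%E by rewrite lte_fin.
  exact: (H _ (open_ereal_lt' e0')).
by exists N => k Nk; exact: HN.
Qed.

End Truncation.

(** * Superposing translates at sparse times *)

Section Superposition.
Context d (X : measurableType d) (R : realType) (mu : {measure set X -> \bar R}).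
Context (f : X -> X) (hf : nonsingular_bimeasurable mu f).
Context (W : set X) (hW : dissipative mu f W).
Context (p : R) (p1 : 1 <= p).
Local Notation mass := (mass mu f W).
Local Notation block := (block f W).
Local Notation zone := (zone f W).

Let p0 : 0 < p. Proof. exact: lt_le_trans p1. Qed.

(** Times at which translates of the zones can be superposed: the l-th zone,
    translated by s l, (1) is disjoint from the other ones, (2) has small measure
    and (3) keeps a small measure after being moved back by any s k with k <> l.
    The factor l ^ p accounts for functions bounded by l, and the factors
    2 ^ l.+1 are those that make [pint_le_series] applicable. *)
Definition sparse_times (s : nat -> nat) :=
  [/\ forall k l, (k < l)%N -> (s k + k + l < s l)%N,
    forall l, ((l%:R `^ p)%:E * mu (zone (s l)%:Z l) <=
      (1 / (2 ^ l.+1)%:R)%:E)%E &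
    forall k l, k != l ->
      ((l%:R `^ p)%:E * mu (zone ((s l)%:Z - (s k)%:Z) l) <=
        (2^-1 ^+ k / (2 ^ l.+1)%:R)%:E)%E].

(** The k-th time need only be chosen with regard to the previous one. Property
    (3) for the pair k, l is secured when the later of the two times is
    chosen: the mass of index s l - s k is at most c ^ (s k) times the mass of
    index s l, and at most c ^ (s l) times the mass of index - s k. *)
Lemma sparse_times_exists : vanishing_masses mu f W ->
  exists s, sparse_times s.
Proof.
move=> V; have [c c1 gc] := mass_growth hf hW.
have c0 : 0 <= c by exact: le_trans c1.
(* C k * mass i bounds k ^ p times the measure of the zone of centre i and
   radius k. *)
pose C (k : nat) : R := k%:R `^ p * (k.*2.+1%:R * c ^+ k).
have C0 k : 0 <= C k by rewrite mulr_ge0 ?powR_ge0// mulr_ge0// exprn_ge0.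
have C_homo k l : (k <= l)%N -> C k <= C l.
  move=> kl; rewrite ler_pM ?powR_ge0 ?mulr_ge0 ?exprn_ge0//.
    by rewrite ge0_ler_powR ?nnegrE ?(ltW p0)// ler_nat.
  by rewrite ler_pM ?exprn_ge0// ?ler_nat ?ltnS ?leq_double// ler_weXn2l.
pose t (k : nat) : R := 2^-1 ^+ k / (2 ^ k.+1)%:R.
have t0 k : 0 < t k by rewrite divr_gt0 ?exprn_gt0 ?ltr0n ?expn_gt0.
have [k a|s Hs] := @recursive_choice (fun k a n => [/\ (a + k.*2 < n)%N,
    C k * (c ^+ a * mass n) <= t k & C k * (c ^+ a * mass (- n%:Z)) <= t k]).
  have Cc : 0 < C k * c ^+ a + 1.
    by rewrite ltr_wpDl// mulr_ge0// exprn_ge0.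
  have [|n [an n1 n2]] := V (t k / (C k * c ^+ a + 1)) (a + k.*2).+1.
    by rewrite divr_gt0.
  have aux m : 0 <= m -> m <= t k / (C k * c ^+ a + 1) ->
      C k * (c ^+ a * m) <= t k.
    move=> m0; rewrite ler_pdivlMr// mulrA; apply: le_trans.
    by rewrite mulrC ler_wpM2l// lerDl.
  by exists n; split => //; apply: aux => //; exact: ltW (mass_gt0 hf hW _).
have lt1 k : (s k <= s k.+1)%N.
  by have [+ _ _] := Hs k; rewrite -addnS; exact/leq_trans/leq_addr.
have s_homo k l : (k <= l)%N -> (s k <= s l)%N.
  by apply: (homo_leq (r := leq)) => //; exact: leq_trans.
have zoneC (i : int) l : ((l%:R `^ p)%:E * mu (zone i l) <= (C l * mass i)%:E)%E.
  apply: le_trans (lee_wpmul2l _ (zone_measure_le hf hW i l c1 gc)) _.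
    by rewrite lee_fin powR_ge0.
  by rewrite -EFinM lee_fin /C !mulrA.
have half1 k : 2^-1 ^+ k <= 1 :> R by rewrite exprn_ile1// invf_le1// ler1n.
exists (fun k => s k.+1); split.
- move=> k l kl; have [H _ _] := Hs l; apply: leq_ltn_trans H.
  by have := s_homo _ _ kl; lia.
- move=> l; apply: le_trans (zoneC _ _) _; rewrite lee_fin.
  have [_ H _] := Hs l; apply: (@le_trans _ _ (t l)).
    apply: le_trans H; rewrite ler_wpM2l//.
    by rewrite ler_peMl ?(ltW (mass_gt0 hf hW _))// exprn_ege1.
  by rewrite ler_pM2r// invr_gt0 ltr0n expn_gt0.
move=> k l; rewrite neq_ltn => /orP[kl|lk];
    apply: le_trans (zoneC _ _) _; rewrite lee_fin.
- have [_ H _] := Hs l; apply: (@le_trans _ _ (t l)).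
    apply: le_trans H; rewrite ler_wpM2l//.
    apply: le_trans (gc _ _) _; rewrite ler_wpM2r ?(ltW (mass_gt0 hf hW _))//.
    by rewrite abszN absz_nat ler_weXn2l// s_homo.
  rewrite ler_pM2r ?invr_gt0 ?ltr0n ?expn_gt0//.
  by rewrite ler_wiXn2l ?invr_ge0// ?invf_le1 ?ler1n// ltnW.
have [_ _ H] := Hs k; apply: (@le_trans _ _ (t k)).
  apply: le_trans H; rewrite ler_pM ?(ltW (mass_gt0 hf hW _))//.
    by rewrite C_homo// ltnW.
  rewrite addrC; apply: le_trans (gc _ _) _.
  rewrite ler_wpM2r ?(ltW (mass_gt0 hf hW _))//.
  by rewrite absz_nat ler_weXn2l// s_homo.
rewrite ler_wpM2l ?exprn_ge0 ?invr_ge0// lef_pV2 ?posrE ?ltr0n ?expn_gt0//.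
by rewrite ler_nat leq_exp2l// ltnS ltnW.
Qed.

(** The function y equals a l o f^(-s l) on the l-th translated zone. At most one
    translated zone contains a given point, and off all of them y vanishes by
    the support condition on a. Hence y o f^(s k) - a k vanishes on the k-th zone,
    and what is left of it lives on the l-th zones moved to s l - s k, with
    l <> k. *)
Lemma superposition (s : nat -> nat) (a : nat -> X -> R[i]) :
  sparse_times s -> (forall l, cmeasurable (a l)) ->
  (forall l x, normc (a l x) <= l%:R) ->
  (forall l x, a l x != 0 -> (`|block x| <= l)%N) ->
  exists y : Lpfun mu p1, forall k,
    (pint mu p (fun x => y (iter (s k) f x) - a k x)%R <= (2^-1 ^+ k)%:E)%E.
Proof.
move=> [sep small smalls] ma ab asupp.
have [g fK gK] := nsb_bij hf.
have gKn n : cancel (iter n g) (iter n f).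
  by elim: n => // n IH x; rewrite iterSr [iter n.+1 g x]iterS gK IH.
have fKn n : cancel (iter n f) (iter n g).
  by elim: n => // n IH x; rewrite iterSr [iter n.+1 f x]iterS fK IH.
have block_g n x : block (iter n g x) = block x - n%:Z.
  by rewrite -[in RHS](gKn n x) (block_iter hf hW) addrK.
have mg n (h : X -> R[i]) :
    cmeasurable h -> cmeasurable (fun x => h (iter n g x)).
  have mgn : measurable_fun [set: X] (iter n g).
    elim: n => [|n IH]; first exact: measurable_id.
    apply: (measurableT_comp _ IH) => _ B mB; rewrite setTI.
    have -> : g @^-1` B = f @` B.
      rewrite eqEsubset; split=> [x Bx|_ [x Bx <-]]; last by rewrite /= fK.
      by exists (g x); rewrite ?gK.
    exact: (nsb_measurable_image hf).
  move=> [hr hi]; split; first exact: (measurableT_comp hr mgn).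
  exact: (measurableT_comp hi mgn).
pose inz (j : int) (l : nat) := (`|j - (s l)%:Z| <= l)%N.
have inz_uniq j k l : inz j k -> inz j l -> k = l.
  wlog kl : k l / (k < l)%N => [H jk jl|].
    by have [kl|lk|//] := ltngtP k l; [exact: H|symmetry; exact: H].
  by have := sep _ _ kl; rewrite /inz; lia.
(* Outside of the zones [lev] is 0, and there [y] below is 0 as well, by [supp]
   at level 0. *)
pose lev (j : int) : nat := xget 0%N [set l | inz j l].
have lev_inz j l : inz j l -> lev j = l.
  move=> jl; apply: (inz_uniq j) => //.
  exact: (@xgetPex _ 0%N [set l | inz j l] (ex_intro _ l jl)).
have supp l x : a l (iter (s l) g x) != 0 -> inz (block x) l.
  by move=> /asupp; rewrite block_g.
pose y x := a (lev (block x)) (iter (s (lev (block x))) g x).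
have my : cmeasurable y.
  split.
    apply: (measurable_fun_block hf hW
      (F := fun j x => complex.Re (a (lev j) (iter (s (lev j)) g x)))) => j.
    by have [] := mg (s (lev j)) _ (ma (lev j)).
  apply: (measurable_fun_block hf hW
    (F := fun j x => complex.Im (a (lev j) (iter (s (lev j)) g x)))) => j.
  by have [] := mg (s (lev j)) _ (ma (lev j)).
have yfin : (pint mu p y < +oo)%E.
  apply: le_lt_trans (ltry 1).
  apply: (@pint_le_series _ _ _ _ _ p1 _ (fun l => zone (s l)%:Z l)) => //.
    by move=> l; exact: (measurable_zone hf hW).
  by move=> x yx; exists (lev (block x));
    [exact: (supp (lev (block x)) x yx)|exact: ab].
exists (LpFun (pint_Lpfun p1 my yfin)) => k /=.
apply: (@pint_le_series _ _ _ _ _ p1 _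
  (fun l => if l == k then set0 else zone ((s l)%:Z - (s k)%:Z) l)).
- exact: (cmeasurableB (cmeasurable_iter hf _ my) (ma k)).
- by move=> l; case: ifP => // _; exact: (measurable_zone hf hW).
- by rewrite exprn_ge0 ?invr_ge0.
- move=> x; rewrite /y (block_iter hf hW).
  set l := lev _; have [->|lk] := eqVneq l k; first by rewrite fKn subrr eqxx.
  have ak0 : a k x = 0.
    apply: contrapT => /eqP/asupp kx; move: lk; rewrite /l (lev_inz _ k) ?eqxx//.
    by rewrite /inz addrK.
  rewrite ak0 subr0 => al; exists l; last exact: ab.
  rewrite (negbTE lk); have := supp _ _ al.
  by rewrite (block_iter hf hW) /inz /zone /=; lia.
move=> l; case: eqVneq => [_|lk].
  by rewrite measure0 mule0 lee_fin divr_ge0// exprn_ge0// invr_ge0.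
by apply: smalls; rewrite eq_sym.
Qed.

End Superposition.

(** * Weak mixing from vanishing masses *)

(** A surjection k |-> (logn 2 k, logn 3 k) onto pairs whose fibres are infinite:
    the power of 5 makes k as large as wanted. *)
Lemma logn_235 a b r :
  logn 2 (2 ^ a * 3 ^ b * 5 ^ r) = a /\ logn 3 (2 ^ a * 3 ^ b * 5 ^ r) = b.
Proof.
rewrite !lognM ?muln_gt0 ?expn_gt0// !lognX !logn_prime//=.
by rewrite !muln1 !muln0 !addn0 add0n.
Qed.

Section WeakMixing.
Context d (X : measurableType d) (R : realType) (mu : {measure set X -> \bar R}).
Context (f : X -> X) (hf : nonsingular_bimeasurable mu f).
Context (W : set X) (hW : dissipative mu f W).
Context (p : R) (p1 : 1 <= p).
Let p0 : 0 < p. Proof. exact: lt_le_trans p1. Qed.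

(** The same times serve for two vectors y and z, which at time s k approximate
    truncations of the elements of the dense sequence numbered logn 2 k and
    logn 3 k. Thus every pair of elements is approximated at infinitely many
    times, in particular at times when both the truncation error and the
    superposition error are small. *)
Lemma vanishing_masses_weakly_mixing : separable (Lp mu p1) ->
  vanishing_masses mu f W -> weakly_mixing (comp_op hf p1).
Proof.
move=> [D /countable_injP[c cinj] /dense_normP dD] V.
have [s Hs] := sparse_times_exists hf hW p1 V.
(* A representative of the element of [D] numbered i; the default 0 fills the
   numbers not in use. *)
pose u (i : nat) : Lpfun mu p1 := repr (xget 0 (D `&` [set v | c v = i])).
have uD v : D v -> \pi_(Lp mu p1) (u (c v)) = v.
  move=> Dv; rewrite reprK.
  have [Dw cw] := @xgetPex _ 0 (D `&` [set w | c w = c v])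
    (ex_intro _ v (conj Dv erefl)).
  by apply: cinj; rewrite ?inE.
have trunc_orbit (e : nat -> nat) : exists y : Lpfun mu p1, forall k,
    (pint mu p (fun x => y (iter (s k) f x) - trunc f W k (u (e k)) x)%R <=
      (2^-1 ^+ k)%:E)%E.
  apply: (superposition hf hW p1 Hs (a := fun k => trunc f W k (u (e k)))).
  - by move=> l; apply: (cmeasurable_trunc hf hW); exact: Lpfun_measurable.
  - by move=> l x; exact: normc_trunc_le.
  - by move=> l x; exact: trunc_support.
have trunc_Lpfun k i : trunc f W k (u i) \in Lpfun_pred mu p1.
  apply: pint_Lpfun.
    exact: (cmeasurable_trunc hf hW _ (Lpfun_measurable _)).
  apply: le_lt_trans (Lpfun_pint (u i)); apply: ge0_le_integral => //.
  - by move=> x _; rewrite lee_fin powR_ge0.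
  - exact: measurable_normcX (cmeasurable_trunc hf hW _ (Lpfun_measurable _)).
  - exact: measurable_normcX (Lpfun_measurable _).
  move=> x _; rewrite lee_fin ge0_ler_powR ?nnegrE ?normc_ge0 ?(ltW p0)//.
  by rewrite /trunc; case: ifP; rewrite ?normc0 ?normc_ge0.
have approx (e : nat -> nat) (y : Lpfun mu p1) v (r : R) : D v -> 0 < r ->
    (forall k, (pint mu p (fun x => y (iter (s k) f x) -
      trunc f W k (u (e k)) x)%R <= (2^-1 ^+ k)%:E)%E) ->
    exists N, forall k, (N <= k)%N -> e k = c v ->
      `|v - iter (s k) (comp_op hf p1) (\pi_(Lp mu p1) y)| < r%:C.
  move=> Dv r0 Hy; have r20 : 0 < r / 2 by rewrite divr_gt0.
  have rp0 : 0 < (r / 2) `^ p by rewrite powR_gt0.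
  have [N1 HN1] := trunc_dense hf hW (u (c v)) rp0.
  have [N2 _ HN2] : \forall k \near \oo, 2^-1 ^+ k < (r / 2) `^ p.
    have h1 : `|2^-1 : R| < 1 by rewrite ger0_norm ?invf_lt1 ?ltr1n ?invr_ge0.
    have /cvgr0_norm_lt/(_ _ rp0) := cvg_expr h1.
    by apply: filterS => k; rewrite ger0_norm// exprn_ge0// invr_ge0.
  exists (N1 + N2)%N => k Nk ek.
  pose w : Lpfun mu p1 := LpFun (trunc_Lpfun k (c v)).
  have -> : r%:C = (r / 2)%:C + (r / 2)%:C by rewrite -rmorphD/= -splitr.
  apply: le_lt_trans (ler_distD (\pi_(Lp mu p1) w) _ _) _; apply: ltrD.
    by rewrite -(uD v Dv) Lp_norm_sub_lt//; apply: HN1; lia.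
  rewrite distrC iter_comp_op Lp_norm_sub_lt//.
  under eq_fun do rewrite iter_comp_LpfunE.
  have := Hy k; rewrite ek => /le_lt_trans; apply; rewrite lte_fin.
  by apply: HN2 => /=; lia.
have [y Hy] := trunc_orbit (logn 2); have [z Hz] := trunc_orbit (logn 3).
exists (\pi_(Lp mu p1) y, \pi_(Lp mu p1) z); apply/dense_prod_normP => v w r r0.
have r20 : 0 < r / 2 by rewrite divr_gt0.
have [v' Dv' vv'] := dD v _ r20; have [w' Dw' ww'] := dD w _ r20.
have [N1 HN1] := approx _ _ _ _ Dv' r20 Hy.
have [N2 HN2] := approx _ _ _ _ Dw' r20 Hz.
pose k := (2 ^ c v' * 3 ^ c w' * 5 ^ (N1 + N2))%N.
have [k2 k3] := logn_235 (c v') (c w') (N1 + N2).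
have Nk : (N1 + N2 <= k)%N.
  apply: leq_trans (ltnW (ltn_expl (N1 + N2) (isT : 1 < 5)%N)) _.
  by rewrite leq_pmull// muln_gt0 !expn_gt0.
eexists; first by exists (s k).
rewrite iter_pair /=.
have -> : r%:C = (r / 2)%:C + (r / 2)%:C by rewrite -rmorphD/= -splitr.
split.
- apply: le_lt_trans (ler_distD v' _ _) _; apply: ltrD => //.
  by apply: HN1 => //; lia.
- apply: le_lt_trans (ler_distD w' _ _) _; apply: ltrD => //.
  by apply: HN2 => //; lia.
Qed.

End WeakMixing.

(** * The equivalence *)

Theorem theorem3p1p1 (R : realType) (d : measure_display) (X : measurableType d)
    (mu : {measure set X -> \bar R}) (mu_sigma_finite : sigma_finite [set: X] mu)
    (f : X -> X) (hf : nonsingular_bimeasurable mu f)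
    (p : R) (p1 : 1 <= p) (Lp_separable : separable (Lp mu p1))
    (W : set X) (f_dissipative : dissipative mu f W)
    (f_distortion : bounded_distortion mu f W) :
  let Tf : Lp mu p1 -> Lp mu p1 := comp_op hf p1 in
  let i := hypercyclic Tf in
  let ii := weakly_mixing Tf in
  let iii := exists n : nat -> nat,
    [/\ forall k, (0 < n k)%N,
        {homo n : k l / (k < l)%N} &
        forall j : int,
          ((mu (zimage f (j - (n k)%:Z) W) / mu (zimage f j W))%E
             @[k --> \oo] --> 0%E) /\
          ((mu (zimage f j W) / mu (zimage f (j + (n k)%:Z) W))%E
             @[k --> \oo] --> +oo%E)] in
  (i <-> ii) /\ (ii <-> iii).
Proof.
move=> Tf i ii iii.
have iii_P : vanishing_masses mu f W <-> iii.
  exact: vanishing_masses_ratioP.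
have i_P : i -> vanishing_masses mu f W.
  exact: hypercyclic_vanishing_masses.
have P_ii : vanishing_masses mu f W -> ii.
  exact: vanishing_masses_weakly_mixing.
have ii_i : ii -> i by exact: weakly_mixing_hypercyclic.
by split; [split=> [/i_P/P_ii|/ii_i]|split=> [/ii_i/i_P/iii_P|/iii_P/P_ii]].
Qed.
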